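(* Assume that $\bar s\neq 0$, $\mathrm{val}\,\mathrm{P}(\bar s)\in\mathbb{R}$, $\nu$ is lower semi-continuous at $\bar s$ and $\mathrm{Sol}\,\mathrm{D}(\bar s)\neq\emptyset$. Let $\{(x^k,y^k,\lambda^k)\}$ be generated by the augmented Lagrangian method with $r_k\ge\underline{r}$ for all $k$ for some $\underline{r}>0$. Then the sequence $\{\lambda^k\}$ diverges (i.e. does not converge).
   Context: Standing setting: $\mathcal{Y}$ is a finite dimensional Hilbert space, $K\subset\mathcal{Y}$ is a nonempty closed convex set, $f:\mathbb{R}^n\to\mathbb{R}$ is convex and continuously differentiable, $g:\mathbb{R}^n\to\mathcal{Y}$ is continuously differentiable, and $G_K(x)=-g(x)+K$ is graph-convex, i.e. $\{(x,s)\in\mathbb{R}^n\times\mathcal{Y}: g(x)+s\in K\}$ is convex. $\mathcal{S}=\{s\in\mathcal{Y}:\exists x\in\mathbb{R}^n,\ g(x)+s\in K\}$ is assumed closed with $0\notin\mathcal{S}$, and $\bar s=\mathrm{argmin}\{\frac12\|s\|^2: s\in\mathcal{S}\}$. For $s\in\mathcal{Y}$, $\mathrm{P}(s)$ is the problem $\min f(x)$ s.t. $g(x)+s\in K$, with optimal value $\mathrm{val}\,\mathrm{P}(s)=\nu(s)=\inf\{f(x): g(x)+s\in K\}$ (with $\inf\emptyset=+\infty$). $\theta(\lambda)=-\inf_{x\in\mathbb{R}^n,\,y\in K}[f(x)+\langle\lambda,g(x)-y\rangle]$; $\mathrm{D}(s)$ is the dual problem $\max_{\lambda\in\mathcal{Y}}[\langle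 s,\lambda\rangle-\theta(\lambda)]$ and $\mathrm{Sol}\,\mathrm{D}(s)$ its set of optimal solutions. The augmented Lagrangian is $l_r(x,y,\lambda)=f(x)+\langle\lambda,g(x)-y\rangle+\frac r2\|g(x)-y\|^2$. Augmented Lagrangian method: start with $\lambda^0\in\mathcal{Y}$ and $r_0>0$; for $k=0,1,2,\dots$: (1) let $(x^{k+1},y^{k+1})$ be a solution of $\min_{x\in\mathbb{R}^n,\,y\in K}l_{r_k}(x,y,\lambda^k)$; (2) set $\lambda^{k+1}=\lambda^k+r_k(g(x^{k+1})-y^{k+1})$; (3) choose $r_{k+1}\ge r_k$. The generated infinite sequence is considered (no stopping). *)

(* Defs.v *)
From HB Require Import structures.
From mathcomp Require Import all_boot all_order all_algebra.
From mathcomp Require Import all_classical all_reals all_analysis.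

Set Implicit Arguments.
Unset Strict Implicit.
Unset Printing Implicit Defensive.

Import Order.TTheory GRing.Theory Num.Theory.
Import numFieldNormedType.Exports.

Local Open Scope classical_set_scope.
Local Open Scope ring_scope.

(* Finite dimensional real Hilbert spaces: a positive definite symmetric
   bilinear form inducing the norm. The Vector structure gives finite
   dimension, hence completeness. *)
HB.mixin Record NormedVector_isHilbert (R : realType) V
    of NormedModule R V & Vector R V := {
  inner : {dot V for (idfun : R -> R)} ;
  innerxx : forall v : V, inner v v = `|v| ^+ 2
}.

#[short(type="finHilbertType")]
HB.structure Definition FinHilbert (R : realType) :=
  {V of NormedVector_isHilbert R V & NormedModule R V & Vector R V}.

Notation "''[' u , v ]" := (inner u%R v%R)
  (at level 0, format "''[' u ,  v ]") : ring_scope.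

(* The last condition is continuity of x |-> 'd h x for the operator norm. *)
Definition continuously_differentiable (R : realType) (U V : normedModType R)
    (h : U -> V) : Prop :=
  (forall x, differentiable h x) /\
  (forall x (e : R), 0 < e ->
     \forall z \near x, forall v, `|'d h z v - 'd h x v| <= e * `|v|).

Definition lower_semicontinuous_at (R : realType) (X : topologicalType)
    (h : X -> \bar R) (x : X) : Prop :=
  forall a : R, (a%:E < h x)%E -> \forall z \near x, (a%:E < h z)%E.

Definition argmin (R : realType) (T : Type) (D : set T) (phi : T -> R) : set T :=
  [set x | D x /\ forall z, D z -> phi x <= phi z].

Section Problem.
Context {R : realType} {n : nat} {Y : finHilbertType R}.
Variables (K : set Y) (f : 'rV[R]_n -> R) (g : 'rV[R]_n -> Y).

Definition GK (x : 'rV[R]_n) : set Y := [set - g x + y | y in K].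

Definition graph_convex (G : 'rV[R]_n -> set Y) : Prop :=
  convex_set (M := ('rV[R]_n * Y)%type) [set p | G p.1 p.2].

Definition feasible_shift : set Y := [set s | exists x, K (g x + s)].

Definition nu (s : Y) : \bar R :=
  ereal_inf [set (f x)%:E | x in [set x | K (g x + s)]].

Definition theta (lambda : Y) : \bar R :=
  (- ereal_inf [set (f p.1 + '[lambda, g p.1 - p.2])%:E
               | p in [set p : 'rV[R]_n * Y | K p.2]])%E.

Definition dual_obj (s lambda : Y) : \bar R :=
  (('[s, lambda])%:E - theta lambda)%E.

(* An optimal solution is in particular feasible, i.e. in the domain of theta;
   without this, every lambda would be a solution when theta is +oo. *)
Definition SolD (s : Y) : set Y :=
  [set lambda | (theta lambda < +oo)%E /\
                forall mu, (dual_obj s mu <= dual_obj s lambda)%E].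

Definition aug_lagrangian (r : R) (x : 'rV[R]_n) (y lambda : Y) : R :=
  f x + '[lambda, g x - y] + r / 2 * `|g x - y| ^+ 2.

(* x 0 and y 0 play no role: the method only produces x k.+1 and y k.+1. *)
Record ALM_sequence (x : nat -> 'rV[R]_n) (y lambda : nat -> Y)
    (r : nat -> R) : Prop := {
  ALM_r0 : 0 < r 0%N ;
  ALM_min : forall k,
    argmin [set p : 'rV[R]_n * Y | K p.2]
      (fun p => aug_lagrangian (r k) p.1 p.2 (lambda k)) (x k.+1, y k.+1) ;
  ALM_mult : forall k,
    lambda k.+1 = lambda k + r k *: (g (x k.+1) - y k.+1) ;
  ALM_r : forall k, r k <= r k.+1
}.

End Problem.

(* Main.v *)
Require Import Defs.
From mathcomp Require Import all_boot all_order all_algebra.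
From mathcomp Require Import all_classical all_reals all_analysis.
Import Order.TTheory GRing.Theory Num.Theory.
Import numFieldNormedType.Exports.
Local Open Scope classical_set_scope.
Local Open Scope ring_scope.

(** Each multiplier step is [r k] times the residual [g (x k.+1) - y k.+1],
    and the opposite of that residual is a feasible shift, because adding
    [y - g x] to [g x] lands on the point [y] of [K]
    ([feasible_shift_residual]).  As [sbar] has least norm among the feasible
    shifts, no residual is shorter than [sbar] ([argmin_half_sqr_norm_le]), so
    every step has length at least [rlow * `|sbar|], a positive constant.  The
    steps of a convergent sequence tend to zero, hence the multipliers cannot
    converge ([not_cvg_steps_bounded_below]). *)

Lemma cvg_successive_diff0 (R : realType) (V : normedModType R)
    (u : nat -> V) : cvg (u @ \oo) -> u k.+1 - u k @[k --> \oo] --> (0 : V).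
Proof.
move=> u_cvg; rewrite -(subrr (lim (u @ \oo))).
by apply: cvgB => //; rewrite (cvg_shiftS u).
Qed.

Lemma not_cvg_steps_bounded_below (R : realType) (V : normedModType R)
    (u : nat -> V) (c : R) :
  0 < c -> (forall k, c <= `|u k.+1 - u k|) -> ~ cvg (u @ \oo).
Proof.
move=> c_gt0 u_step /cvg_successive_diff0/cvgr0_norm_lt/(_ c c_gt0)[N _].
by move=> /(_ N (leqnn N)) /=; rewrite ltNge u_step.
Qed.

Lemma argmin_half_sqr_norm_le (R : realType) (V : normedModType R)
    (D : set V) (s t : V) :
  argmin D (fun v => 2^-1 * `|v| ^+ 2) s -> D t -> `|s| <= `|t|.
Proof.
move=> [_ s_min] /s_min.
by rewrite ler_pM2l ?invr_gt0 ?ltr0n// ler_sqr ?nnegrE.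
Qed.

Lemma feasible_shift_residual (R : realType) (n : nat) (Y : finHilbertType R)
    (K : set Y) (g : 'rV[R]_n -> Y) (x : 'rV[R]_n) (y : Y) :
  K y -> feasible_shift K g (y - g x).
Proof. by move=> Ky; exists x; rewrite addrC subrK. Qed.

Theorem corollary4p1 (R : realType) (n : nat) (Y : finHilbertType R)
    (K : set Y) (f : 'rV[R]_n -> R) (g : 'rV[R]_n -> Y) (sbar : Y)
    (x : nat -> 'rV[R]_n) (y lambda : nat -> Y) (r : nat -> R) (rlow : R)
    (K_nonempty : K !=set0) (K_closed : closed K) (K_convex : convex_set K)
    (f_convex : convex_function (E := 'rV[R]_n) setT f)
    (f_C1 : continuously_differentiable f)
    (g_C1 : continuously_differentiable g)
    (G_convex : graph_convex (GK K g))
    (S_closed : closed (feasible_shift K g))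
    (S_0 : ~ feasible_shift K g 0)
    (sbar_min : argmin (feasible_shift K g) (fun s => 2^-1 * `|s| ^+ 2) sbar)
    (sbar_neq0 : sbar != 0)
    (val_real : nu K f g sbar \is a fin_num)
    (nu_lsc : lower_semicontinuous_at (nu K f g) sbar)
    (SolD_nonempty : SolD K f g sbar !=set0)
    (alm : ALM_sequence K f g x y lambda r)
    (rlow_gt0 : 0 < rlow) (r_ge : forall k, rlow <= r k) :
  ~ cvg (lambda @ \oo).
Proof.
apply: (@not_cvg_steps_bounded_below _ _ _ (rlow * `|sbar|)) => [|k].
  by rewrite mulr_gt0 ?normr_gt0.
have r_ge0 : 0 <= r k := le_trans (ltW rlow_gt0) (r_ge k).
rewrite (ALM_mult alm) addrC addKr normrZ ger0_norm// distrC.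
rewrite ler_pM ?(ltW rlow_gt0)//.
apply: argmin_half_sqr_norm_le sbar_min _; apply: feasible_shift_residual.
by have [] := ALM_min alm k.
Qed.
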